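(* Let $G$ be a group, $M$ a connected $G$-set, and $\Gamma$ a connecting graph structure for $M$ such that the action of $G$ on the set $\Gamma^1$ of edges is proper (edge stabilizers are finite). Let $\mathcal U$ be a relatively hyperbolic uniformity on $M$. Then for every entourage $\mathbf v\in\mathcal U$ there exists a finite set $E\subset\Gamma^1$ such that $\mathbf v$ contains the boundary pair $\partial I$ (the pair of endpoints) of every geodesic segment $I$ of $\Gamma$ that misses $E$ (i.e. contains no edge of $E$).
   Context: $\mathsf S^2M$ is the set of unordered pairs (repetition allowed) of elements of $M$, and $\Delta^2M$ is the set of pairs $\{x,x\}$. For $\mathbf u\subset \mathsf S^2M$ with $\mathbf u\supset\Delta^2M$ and $n\ge1$, $\mathbf u^n$ is the set of pairs $\{x,y\}$ for which there are $x=x_0,\dots,x_n=y$ with $\{x_{i-1},x_i\}\in\mathbf u$. A uniformity on $M$ is a filter $\mathcal U$ of subsets of $\mathsf S^2M$ containing $\Delta^2M$ (its elements are called entourages) such that for every $\mathbf u\in\mathcal U$ there is $\mathbf v\in\mathcal U$ with $\mathbf v^2\subset\mathbf u$. The completion $\overline M$ of $(M,\mathcal U)$ is the (Hausdorff) space of minimal Cauchy filters, with canonical map $\iota:M\to\overline M$; the $\mathcal U$-boundary is $\overline M\setminus\iota(M)$. Graphs are without loops and multiple edges, and are not assumed locally finite. A $G$-set $M$ is connected if there is a connected graph $\Gamma$ with an action of $G$ by automorphisms, vertex set $\Gamma^0=M$ as a $G$-set, and $\Gamma^1/G$ finite; such a $\Gamma$ is called a connecting (graph) structure for $M$. Geodesic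 segments are with respect to the graph metric. A divider on a connected $G$-set $M$ is a set $\mathbf u\subset\mathsf S^2M$ containing $\Delta^2M$ for which there is a finite $F\subset G$ with $\bigl(\bigcap_{f\in F}f\mathbf u\bigr)^2\subset\mathbf u$. The filter generated by $\{g\mathbf u:g\in G\}$ is a uniformity, the uniformity generated by $\mathbf u$. A divider $\mathbf u$ is perspective if for every pair $\beta$ of points of $M$ the set $\{g\in G: g\beta\notin\mathbf u\}$ is finite. A uniformity $\mathcal U$ on a connected $G$-set $M$ is relatively hyperbolic if it is generated by a perspective divider and the $\mathcal U$-boundary has at least two points. *)

(* Defs.v *)
From HB Require Import structures.
From mathcomp Require Import all_boot.
From mathcomp Require Import all_classical.

Set Implicit Arguments.
Unset Strict Implicit.
Unset Printing Implicit Defensive.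

Local Open Scope classical_set_scope.

(* Unordered pairs, repetition allowed: S2 M is the set of subsets of M of the
   form {x, y}. *)
Definition S2 (M : Type) : Type :=
  {A : set M | exists x y, A = [set x; y]}.

Definition pair2 (M : Type) (x y : M) : S2 M :=
  exist _ [set x; y] (ex_intro _ x (ex_intro _ y erefl)).

Definition diag2 (M : Type) : set (S2 M) := [set pair2 x x | x in setT].

Lemma pair2C (M : Type) (x y : M) : pair2 x y = pair2 y x.
Proof. by apply: eq_exist; rewrite setUC. Qed.

Lemma pair2P (M : Type) (p : S2 M) : exists x y, p = pair2 x y.
Proof. by case: p => A [x [y eA]]; exists x, y; apply: eq_exist. Qed.

Lemma pair2_inj (M : Type) (x y x' y' : M) :
  pair2 x y = pair2 x' y' -> (x = x' /\ y = y') \/ (x = y' /\ y = x').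
Proof.
move=> /(congr1 sval) /= e.
have hx : [set x'; y'] x by rewrite -e; left.
have hy : [set x'; y'] y by rewrite -e; right.
have hx' : [set x; y] x' by rewrite e; left.
have hy' : [set x; y] y' by rewrite e; right.
move: hx hy hx' hy' => [] -> [] -> [] h [] h'; auto.
Qed.

(* Only the values x 0, ..., x n matter. *)
Definition is_chain (M : Type) (u : set (S2 M)) (n : nat) (x : nat -> M) : Prop :=
  forall i, (i < n)%N -> u (pair2 (x i) (x i.+1)).

Definition power2 (M : Type) (u : set (S2 M)) (n : nat) : set (S2 M) :=
  [set p | exists2 x : nat -> M, is_chain u n x & p = pair2 (x 0%N) (x n)].

Definition is_uniformity (M : Type) (U : set_system (S2 M)) : Prop :=
  [/\ Filter U,
      forall u, U u -> @diag2 M `<=` u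
    & forall u, U u -> exists2 v, U v & power2 v 2 `<=` u].

Definition is_cauchy (M : Type) (U : set_system (S2 M)) (F : set_system M) : Prop :=
  ProperFilter F /\
  forall u, U u -> exists2 A, F A & forall x y, A x -> A y -> u (pair2 x y).

Definition completion (M : Type) (U : set_system (S2 M)) : set (set_system M) :=
  [set F | is_cauchy U F /\ forall F', is_cauchy U F' -> F' `<=` F -> F' = F].

(* The canonical map sends x to its neighbourhood filter, which is the minimal
   Cauchy filter contained in the principal filter of x. *)
Definition iota_completion (M : Type) (U : set_system (S2 M)) (x : M) : set_system M :=
  [set A | exists2 u, U u & [set y | u (pair2 x y)] `<=` A].

Definition boundary (M : Type) (U : set_system (S2 M)) : set (set_system M) :=
  completion U `\` range (iota_completion U).

Record gset (G : groupType) (M : Type) := GSet {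
  gact :> G -> M -> M;
  gact1 : forall x, gact 1%g x = x;
  gactM : forall g h x, gact (g * h)%g x = gact g (gact h x)
}.

Lemma act2_subproof (G : groupType) (M : Type) (a : gset G M) (g : G) (p : S2 M) :
  exists x y, a g @` sval p = [set x; y].
Proof.
by case: (svalP p) => x [y ->]; exists (a g x), (a g y); rewrite image_setU !image_set1.
Qed.

Definition act2 (G : groupType) (M : Type) (a : gset G M) (g : G) (p : S2 M) : S2 M :=
  exist _ (a g @` sval p) (act2_subproof a g p).

Lemma act2_pair2 (G : groupType) (M : Type) (a : gset G M) (g : G) (x y : M) :
  act2 a g (pair2 x y) = pair2 (a g x) (a g y).
Proof. by apply: eq_exist; rewrite image_setU !image_set1. Qed.

(* Graphs without loops and multiple edges: an edge is identified with the pair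
   of its (distinct) endpoints. *)
Record graph (V : Type) := Graph {
  edges : set (S2 V);
  edges_noloop : forall x, ~ edges (pair2 x x)
}.

Definition connected_graph (V : Type) (Gamma : graph V) : Prop :=
  forall x y : V, exists n (p : nat -> V),
    [/\ is_chain (edges Gamma) n p, p 0%N = x & p n = y].

(* The graph metric: the least length of a path from x to y.  The value is
   meaningful only when x and y are joined by a path. *)
Definition gdist (V : Type) (Gamma : graph V) (x y : V) : nat :=
  let lengths := [set n | exists p : nat -> V,
    [/\ is_chain (edges Gamma) n p, p 0%N = x & p n = y]] in
  get [set n | lengths n /\ forall m, lengths m -> (n <= m)%N].

(* The geodesic segment of length n with successive vertices p 0, ..., p n. *)
Definition is_geodesic (V : Type) (Gamma : graph V) (n : nat) (p : nat -> V) : Prop :=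
  is_chain (edges Gamma) n p /\
  forall i j, (i <= j <= n)%N -> gdist Gamma (p i) (p j) = (j - i)%N.

Definition segment_edges (V : Type) (n : nat) (p : nat -> V) : set (S2 V) :=
  [set pair2 (p i) (p i.+1) | i in [set i | (i < n)%N]].

Definition segment_boundary (V : Type) (n : nat) (p : nat -> V) : S2 V :=
  pair2 (p 0%N) (p n).

Definition edge_orbits (G : groupType) (M : Type) (a : gset G M) (Gamma : graph M) :
    set (set (S2 M)) :=
  [set [set act2 a g e | g in setT] | e in edges Gamma].

Definition connecting (G : groupType) (M : Type) (a : gset G M) (Gamma : graph M) : Prop :=
  [/\ connected_graph Gamma,
      forall g e, edges Gamma e -> edges Gamma (act2 a g e)
    & finite_set (edge_orbits a Gamma)].

Definition connected_gset (G : groupType) (M : Type) (a : gset G M) : Prop :=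
  exists Gamma : graph M, connecting a Gamma.

(* The stabilizer is that of the unordered pair: inversions are allowed. *)
Definition proper_on_edges (G : groupType) (M : Type) (a : gset G M)
    (Gamma : graph M) : Prop :=
  forall e, edges Gamma e -> finite_set [set g : G | act2 a g e = e].

Definition is_divider (G : groupType) (M : Type) (a : gset G M) (u : set (S2 M)) : Prop :=
  @diag2 M `<=` u /\
  exists2 F : set G, finite_set F &
    power2 (\bigcap_(f in F) (act2 a f @` u)) 2 `<=` u.

Definition generated_uniformity (G : groupType) (M : Type) (a : gset G M)
    (u : set (S2 M)) : set_system (S2 M) :=
  smallest (@Filter (S2 M)) [set act2 a g @` u | g in setT].

Definition is_perspective (G : groupType) (M : Type) (a : gset G M)
    (u : set (S2 M)) : Prop :=
  forall b : S2 M, finite_set [set g : G | ~ u (act2 a g b)].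

Definition relatively_hyperbolic (G : groupType) (M : Type) (a : gset G M)
    (U : set_system (S2 M)) : Prop :=
  [/\ is_uniformity U,
      exists u, [/\ is_divider a u, is_perspective a u & U = generated_uniformity a u]
    & exists F1 F2, [/\ boundary U F1, boundary U F2 & F1 <> F2]].

(* Main.v *)
Require Import Defs.
From mathcomp Require Import all_boot.
From mathcomp Require Import all_classical.
From mathcomp Require Import zify.

(** Write u for a divider generating the uniformity and F for a finite subset of
    G such that the square of the intersection of the f u (f in F) lies in u.
    Iterating the intersection over F gives levels u_0 = u, u_1, ... with
    u_(n+1)^2 contained in u_n ([divider_level_comp]).

    Passing from u_n to u_(n+1) translates the set of edges outside u_n by the
    finitely many elements of F.  As the divider is perspective and there are
    finitely many orbits of edges, only finitely many edges lie outside u_0;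
    hence only finitely many lie outside u_n ([finite_bad_edges]), and their
    distance to a fixed vertex o is at most linear in n ([bad_edge_within]).  Two
    vertices of a geodesic that are both R-close to o are at most 2R steps apart,
    so the edges of a geodesic outside u_n occupy a window of length K (n + 1),
    where K does not depend on the geodesic.

    The square condition says that an edge in u_n weighs about 2^(-n), and a
    chain of small total weight has its boundary in u_0.  If a geodesic has all
    its edges in u_N, the weights along it decay exponentially on both sides of
    some vertex after a window of length linear in N, so that the total weight
    is small for large N ([chain_boundary_level]).  Therefore the finite set of
    edges outside u_N serves for v = u.  Finally, the sets v for which some finite
    set of edges serves form a filter, which contains with u all its translates
    ([filter_controlled], [controlled_act]). *)

Set Implicit Arguments.
Unset Strict Implicit.
Unset Printing Implicit Defensive.

Local Open Scope classical_set_scope.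

(** * Chains whose links lie in a sequence of shrinking sets of pairs *)

Lemma power2_2_sub (M : Type) (v w : set (S2 M)) (x y z : M) :
  power2 v 2 `<=` w -> v (pair2 x y) -> v (pair2 y z) -> w (pair2 x z).
Proof.
move=> vw vxy vyz; apply: vw.
exists (fun i => if i is i'.+1 then if i' is 0 then y else z else x) => //.
by case=> [|[|]].
Qed.

(** The levels decrease because they contain the diagonal. *)
Lemma level_le (M : Type) (u : nat -> set (S2 M)) (m n : nat) (x y : M) :
    (forall n x, u n (pair2 x x)) ->
    (forall n x y z, u n.+1 (pair2 x y) -> u n.+1 (pair2 y z) -> u n (pair2 x z)) ->
  (m <= n)%N -> u n (pair2 x y) -> u m (pair2 x y).
Proof.
move=> udiag ucomp /subnKC <-; elim: (n - m)%N => [|k IHk]; first by rewrite addn0.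
by rewrite addnS => uxy; apply: IHk; apply: ucomp uxy (udiag _ _).
Qed.

(** Halving the chain k times costs k levels. *)
Lemma chain_pow2_level (M : Type) (u : nat -> set (S2 M)) (y : nat -> M)
    (k n i l : nat) :
    (forall n x, u n (pair2 x x)) ->
    (forall n x y z, u n.+1 (pair2 x y) -> u n.+1 (pair2 y z) -> u n (pair2 x z)) ->
    (l <= 2 ^ k)%N ->
    (forall j, (i <= j < i + l)%N -> u (n + k)%N (pair2 (y j) (y j.+1))) ->
  u n (pair2 (y i) (y (i + l)%N)).
Proof.
move=> udiag ucomp; elim: k n i l => [|k IHk] n i l.
  rewrite expn0 addn0; case: l => [|[|//]] _ ul; first by rewrite addn0.
  by rewrite addn1; apply: ul; lia.
rewrite expnS => lk ul.
pose l1 := minn l (2 ^ k)%N; pose l2 := (l - l1)%N.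
have -> : (i + l = i + l1 + l2)%N by rewrite /l2 /l1; lia.
apply: (ucomp _ _ (y (i + l1)%N)).
  by apply: IHk => [|j jl]; [rewrite /l1; lia|rewrite addSnnS; apply: ul; lia].
by apply: IHk => [|j jl]; [lia|rewrite addSnnS; apply: ul; lia].
Qed.

(** The exponent beats the linear length of the pieces in
    [ray_boundary_level]. *)
Lemma linear_le_exp2 (K j : nat) : (K * (2 * (K + j) + 9) <= 2 ^ (K + (K + j + 4)))%N.
Proof.
rewrite expnD leq_mul //; first exact/ltnW/ltn_expl.
by rewrite expnD; have := ltn_expl (K + j) (isT : 1 < 2)%N; lia.
Qed.

(** Cut the chain at b_0 = 0 and b_j = K (m_j + 1), where m_j = 2 j + 2 K + 6.
    Beyond b_j the links lie in u_(m_j); the piece from b_j to b_(j+1) has at most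
    2^(m_j - j - 2) links and thus its boundary lies in u_(j+2).  Joining the
    pieces from the far end, each junction costs one level, and the part beyond
    b_j has its boundary in u_(j+1). *)
Lemma ray_boundary_level (M : Type) (u : nat -> set (S2 M)) (K t : nat) (y : nat -> M) :
    (forall n x, u n (pair2 x x)) ->
    (forall n x y z, u n.+1 (pair2 x y) -> u n.+1 (pair2 y z) -> u n (pair2 x z)) ->
    (0 < K)%N -> is_chain (u (2 * K + 6)%N) t y ->
    (forall n j, (j < t)%N -> (K * n.+1 <= j)%N -> u n (pair2 (y j) (y j.+1))) ->
  u 1%N (pair2 (y 0%N) (y t)).
Proof.
move=> udiag ucomp K0 uall ufar.
pose m j := (2 * j + 2 * K + 6)%N.
pose b j := if j is 0 then 0%N else (K * (m j).+1)%N.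
have ub j i : (b j <= i < t)%N -> u (m j) (pair2 (y i) (y i.+1)).
  by case: j => [|j] /andP[bi it]; [exact: uall|exact: ufar].
have b_exp j : (b j.+1 <= 2 ^ (2 * K + j + 4))%N.
  rewrite [X in (2 ^ X)%N](_ : _ = K + (K + j + 4))%N; last by lia.
  by have := linear_le_exp2 K j; rewrite /b /m; nia.
have b_lt j : (b j < b j.+1)%N by case: j => [|j]; rewrite /b /m; nia.
suff H k j : (b j <= t)%N -> (t - b j < k)%N -> u j.+1 (pair2 (y (b j)) (y t)).
  by apply: (H t.+1 0%N) => //; rewrite subn0.
elim: k j => [//|k IHk] j bt tk.
have piece s : (b j <= s <= t)%N -> (s <= b j.+1)%N ->
    u j.+2 (pair2 (y (b j)) (y s)).
  move=> bs sb; have -> : s = (b j + (s - b j))%N by lia.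
  apply: (@chain_pow2_level _ u y (2 * K + j + 4)) => // [|i ib].
    by have := b_exp j; lia.
  by rewrite (_ : _ + _ = m j)%N; [apply: ub; lia|rewrite /m; lia].
have bj := b_lt j; have [tb|bt'] := leqP t (b j.+1).
  by apply: (@level_le _ u _ j.+2) => //; apply: piece; lia.
by apply: (ucomp _ _ (y (b j.+1))); [apply: piece|apply: IHk]; lia.
Qed.

(** A link that leaves the sequence u_n at the earliest possible level n is close
    to the links outside u_n for every n, so both halves of the chain seen from
    it satisfy [ray_boundary_level]. *)
Lemma chain_boundary_level (M : Type) (u : nat -> set (S2 M)) (K l : nat) (p : nat -> M) :
    (forall n x, u n (pair2 x x)) ->
    (forall n x y z, u n.+1 (pair2 x y) -> u n.+1 (pair2 y z) -> u n (pair2 x z)) ->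
    (0 < K)%N -> is_chain (u (2 * K + 6)%N) l p ->
    (forall n i j, (i <= j < l)%N -> ~ u n (pair2 (p i) (p i.+1)) ->
       ~ u n (pair2 (p j) (p j.+1)) -> (j - i < K * n.+1)%N) ->
  u 0%N (pair2 (p 0%N) (p l)).
Proof.
move=> udiag ucomp K0 uall uwin.
have [c cl cwin] : exists2 c, (c <= l)%N &
    forall n i, (i < l)%N -> ~ u n (pair2 (p i) (p i.+1)) ->
      (i - c < K * n.+1)%N /\ (c - i < K * n.+1)%N.
  pose bad n i := (i < l)%N /\ ~ u n (pair2 (p i) (p i.+1)).
  have [exbad|nobad] := pselect (exists n, `[< exists i, bad n i >]); last first.
    by exists l => // n i il nu; case: nobad; exists n; apply/asboolP; exists i.
  case: (ex_minnP exbad) => n0 /asboolP[c [cl cbad]] n0min.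
  exists c => [|n i il nu]; first exact: ltnW.
  have n0n : (n0 <= n)%N by apply: n0min; apply/asboolP; exists i.
  have ncu : ~ u n (pair2 (p c) (p c.+1)) by move=> /(level_le udiag ucomp n0n).
  have [ci|ic] := leqP c i.
    by have := uwin n c i; rewrite ci il => /(_ isT ncu nu); nia.
  by have := uwin n i c; rewrite (ltnW ic) cl => /(_ isT nu ncu); nia.
apply: (ucomp _ _ (p c)).
  have -> : pair2 (p 0%N) (p c) = pair2 (p (c - 0)%N) (p (c - c)%N).
    by rewrite subn0 subnn pair2C.
  apply: (@ray_boundary_level _ u K c (fun j => p (c - j)%N)) => //.
    move=> j jc; rewrite pair2C (_ : c - j = (c - j.+1).+1)%N; last by lia.
    by apply: uall; lia.
  move=> n j jc Kj; rewrite pair2C (_ : c - j = (c - j.+1).+1)%N; last by lia.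
  by apply: contrapT => /cwin; lia.
have -> : pair2 (p c) (p l) = pair2 (p (c + 0)%N) (p (c + (l - c))%N).
  by rewrite addn0 subnKC.
apply: (@ray_boundary_level _ u K _ (fun j => p (c + j)%N)) => // [j jc|n j jc Kj].
  by rewrite (addnS c); apply: uall; lia.
by rewrite (addnS c); apply: contrapT => /cwin; lia.
Qed.

(** * Walks in a graph with a group action *)

Lemma act2M (G : groupType) (M : Type) (a : gset G M) (g h : G) (p : S2 M) :
  act2 a g (act2 a h p) = act2 a (g * h)%g p.
Proof. by have [x [y ->]] := pair2P p; rewrite !act2_pair2 !gactM. Qed.

Lemma act2K (G : groupType) (M : Type) (a : gset G M) (g : G) :
  cancel (act2 a g) (act2 a g^-1%g).
Proof.
by move=> p; have [x [y ->]] := pair2P p; rewrite act2M mulVg act2_pair2 !gact1.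
Qed.

Lemma act2VK (G : groupType) (M : Type) (a : gset G M) (g : G) :
  cancel (act2 a g^-1%g) (act2 a g).
Proof. by move=> p; rewrite -{1}(invgK g) act2K. Qed.

Definition walk (M : Type) (Gamma : graph M) (n : nat) (x y : M) : Prop :=
  exists p : nat -> M, [/\ is_chain (edges Gamma) n p, p 0%N = x & p n = y].

Definition within (M : Type) (Gamma : graph M) (n : nat) (x y : M) : Prop :=
  exists2 m, (m <= n)%N & walk Gamma m x y.

Lemma walk_sym (M : Type) (Gamma : graph M) (n : nat) (x y : M) :
  walk Gamma n x y -> walk Gamma n y x.
Proof.
move=> [p [pE px py]]; exists (fun i => p (n - i)%N); rewrite subn0 subnn.
split=> // i i_n; rewrite pair2C (_ : n - i = (n - i.+1).+1)%N; last by lia.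
by apply: pE; lia.
Qed.

Lemma walk_cat (M : Type) (Gamma : graph M) (m n : nat) (x y z : M) :
  walk Gamma m x y -> walk Gamma n y z -> walk Gamma (m + n) x z.
Proof.
move=> [p [pE px py]] [q [qE qy qz]].
exists (fun i => if (i < m)%N then p i else q (i - m)%N); split.
- move=> i imn; have [im|mi] := ltnP i m; last first.
    by rewrite ltnNge leqW // subSn //; apply: qE; lia.
  have [im'|mi'] := ltnP i.+1 m; first exact: pE.
  rewrite (_ : i.+1 - m = 0)%N; last by lia.
  by rewrite qy -py (_ : m = i.+1); [apply: pE|]; lia.
- by case: m {pE} py => [|m] // py; rewrite subn0 qy -py.
- by rewrite ltnNge leq_addr addKn.
Qed.

Lemma walk_act (G : groupType) (M : Type) (a : gset G M) (Gamma : graph M)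
    (g : G) (n : nat) (x y : M) :
    (forall g e, edges Gamma e -> edges Gamma (act2 a g e)) ->
  walk Gamma n x y -> walk Gamma n (a g x) (a g y).
Proof.
move=> Einv [p [pE <- <-]]; exists (a g \o p); split=> // i i_n.
by rewrite /= -act2_pair2; apply/Einv/pE.
Qed.

Lemma within_act (G : groupType) (M : Type) (a : gset G M) (Gamma : graph M)
    (g : G) (n : nat) (x y : M) :
    (forall g e, edges Gamma e -> edges Gamma (act2 a g e)) ->
  within Gamma n x y -> within Gamma n (a g x) (a g y).
Proof. by move=> Einv [m mn w]; exists m => //; apply: walk_act. Qed.

Lemma within_trans (M : Type) (Gamma : graph M) (m n : nat) (x y z : M) :
  within Gamma m x y -> within Gamma n y z -> within Gamma (m + n) x z.
Proof.
move=> [m' mm w] [n' nn w']; exists (m' + n')%N; first exact: leq_add.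
exact: walk_cat w w'.
Qed.

Lemma gdist_le_walk (M : Type) (Gamma : graph M) (n : nat) (x y : M) :
  walk Gamma n x y -> (gdist Gamma x y <= n)%N.
Proof.
move=> w; pose minimal m := walk Gamma m x y /\ forall k, walk Gamma k x y -> (m <= k)%N.
have exw : exists n, `[< walk Gamma n x y >] by exists n; apply/asboolP.
case: (ex_minnP exw) => m /asboolP mw mmin.
have /getPex[_] : exists m, minimal m.
  by exists m; split=> // k kw; apply: mmin; apply/asboolP.
exact.
Qed.

(** Geodesicity in terms of walks, the form in which it is preserved by the
    action. *)
Definition shortest (M : Type) (Gamma : graph M) (n : nat) (p : nat -> M) : Prop :=
  is_chain (edges Gamma) n p /\
  forall i j m, (i <= j <= n)%N -> walk Gamma m (p i) (p j) -> (j - i <= m)%N.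

Lemma geodesic_shortest (M : Type) (Gamma : graph M) (n : nat) (p : nat -> M) :
  is_geodesic Gamma n p -> shortest Gamma n p.
Proof. by move=> [pE pd]; split=> // i j m /pd <-; apply: gdist_le_walk. Qed.

Lemma shortest_act (G : groupType) (M : Type) (a : gset G M) (Gamma : graph M)
    (g : G) (n : nat) (p : nat -> M) :
    (forall g e, edges Gamma e -> edges Gamma (act2 a g e)) ->
  shortest Gamma n p -> shortest Gamma n (a g \o p).
Proof.
move=> Einv [pE pd]; split=> [i i_n|i j m ijn w].
  by rewrite /= -act2_pair2; apply/Einv/pE.
apply: pd ijn _; have := walk_act g^-1 Einv w.
by rewrite /= -!gactM mulVg !gact1.
Qed.

(** The walk from p i to p j through o has length at most 2 R. *)
Lemma shortest_within (M : Type) (Gamma : graph M) (n R i j : nat) (p : nat -> M)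
    (o : M) :
    shortest Gamma n p -> (i <= j <= n)%N ->
    within Gamma R o (p i) -> within Gamma R o (p j) ->
  (j - i <= 2 * R)%N.
Proof.
move=> [_ pd] ijn [r rR w] [s sR w'].
by apply: leq_trans (pd _ _ _ ijn (walk_cat (walk_sym w) w')) _; lia.
Qed.

Lemma finite_set_uniform_bound (T : Type) (A : set T) (P : T -> nat -> Prop) :
    finite_set A -> (forall x, exists n, P x n) ->
  exists N, forall x, A x -> exists2 n, (n <= N)%N & P x n.
Proof.
move=> finA /choice[f fP].
have /finite_seqP[s sE] : finite_set (f @` A) by exact: finite_image.
exists (\max_(n <- s) n)%N => x Ax; exists (f x) => //.
have fs : f x \in s.
  by have : (f @` A) (f x) by []; rewrite sE.
exact: (@leq_bigmax_seq _ s xpredT id).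
Qed.

(** * The levels of a divider *)

Fixpoint divider_level (G : groupType) (M : Type) (a : gset G M) (F : set G)
    (u : set (S2 M)) (n : nat) : set (S2 M) :=
  if n is n'.+1 then
    [set p | forall f, F f -> divider_level a F u n' (act2 a f^-1%g p)]
  else u.

Lemma divider_level_diag (G : groupType) (M : Type) (a : gset G M) (F : set G)
    (u : set (S2 M)) (n : nat) (x : M) :
  @diag2 M `<=` u -> divider_level a F u n (pair2 x x).
Proof.
move=> du; elim: n x => [|n IHn] x /=; first by apply: du; exists x.
by move=> f _; rewrite act2_pair2.
Qed.

Lemma divider_level_comp (G : groupType) (M : Type) (a : gset G M) (F : set G)
    (u : set (S2 M)) (n : nat) (x y z : M) :
    power2 (\bigcap_(f in F) (act2 a f @` u)) 2 `<=` u ->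
    divider_level a F u n.+1 (pair2 x y) ->
    divider_level a F u n.+1 (pair2 y z) ->
  divider_level a F u n (pair2 x z).
Proof.
move=> Fu; elim: n x y z => [|n IHn] x y z.
  move=> uxy uyz; apply: (power2_2_sub Fu) => f Ff.
    by exists (act2 a f^-1 (pair2 x y)); [exact: uxy|rewrite act2VK].
  by exists (act2 a f^-1 (pair2 y z)); [exact: uyz|rewrite act2VK].
move=> uxy uyz f Ff; rewrite act2_pair2.
apply: (IHn _ (a f^-1%g y)).
  by rewrite -act2_pair2; apply: uxy.
by rewrite -act2_pair2; apply: uyz.
Qed.

Definition bad_edges (M : Type) (Gamma : graph M) (u : set (S2 M)) : set (S2 M) :=
  edges Gamma `\` u.

Lemma bad_edges_levelS (G : groupType) (M : Type) (a : gset G M) (Gamma : graph M)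
    (F : set G) (u : set (S2 M)) (n : nat) (e : S2 M) :
    (forall g e, edges Gamma e -> edges Gamma (act2 a g e)) ->
    bad_edges Gamma (divider_level a F u n.+1) e ->
  exists2 f, F f & bad_edges Gamma (divider_level a F u n) (act2 a f^-1%g e).
Proof.
move=> Einv [Ee /existsNP[f /not_implyP[Ff nu]]].
by exists f => //; split=> //; apply: Einv.
Qed.

(** In each orbit of edges, perspectivity leaves finitely many translates of a
    representative outside u. *)
Lemma perspective_finite_bad_edges (G : groupType) (M : Type) (a : gset G M)
    (Gamma : graph M) (u : set (S2 M)) :
    connecting a Gamma -> is_perspective a u ->
  finite_set (bad_edges Gamma u).
Proof.
move=> [_ _ finorb] persp.
apply: (@sub_finite_set _ _ (\bigcup_(O in edge_orbits a Gamma) (O `\` u))).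
  move=> e [Ee nu]; exists [set act2 a g e | g in setT]; first by exists e.
  split=> //; exists 1%g => //.
  by have [x [y ->]] := pair2P e; rewrite act2_pair2 !gact1.
apply: bigcup_finite => // _ [e Ee <-].
apply: sub_finite_set (finite_image (act2 a ^~ e) (persp e)).
by move=> _ [[g _ <-] nu]; exists g.
Qed.

Lemma finite_bad_edges (G : groupType) (M : Type) (a : gset G M) (Gamma : graph M)
    (F : set G) (u : set (S2 M)) (n : nat) :
    connecting a Gamma -> finite_set F -> is_perspective a u ->
  finite_set (bad_edges Gamma (divider_level a F u n)).
Proof.
move=> conn finF persp; have [_ Einv _] := conn.
elim: n => [|n IHn]; first exact: perspective_finite_bad_edges conn persp.
apply: (@sub_finite_set _ _
  (\bigcup_(f in F) (act2 a f @` bad_edges Gamma (divider_level a F u n)))).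
  move=> e /(bad_edges_levelS Einv)[f Ff fe].
  by exists f => //; exists (act2 a f^-1%g e) => //; rewrite act2VK.
by apply: bigcup_finite => // f _; apply: finite_image.
Qed.

(** If A bounds the displacement of o under F, and B the distance from o to the
    edges outside u, then the edges outside level n are at distance at most
    n A + B: such an edge is the translate by some f in F of an edge outside level
    n - 1, and f moves o by at most A. *)
Lemma bad_edge_within (G : groupType) (M : Type) (a : gset G M) (Gamma : graph M)
    (F : set G) (u : set (S2 M)) (o : M) :
    connecting a Gamma -> finite_set F -> is_perspective a u ->
  exists C, forall n x y,
    bad_edges Gamma (divider_level a F u n) (pair2 x y) ->
    within Gamma (C * n.+1) o x.
Proof.
move=> conn finF persp; have [Gconn Einv _] := conn.
have [A dA] := finite_set_uniform_bound finF (fun f => Gconn o (a f o)).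
have exB (e : S2 M) : exists n, forall x, sval e x -> within Gamma n o x.
  have [x [y ->]] := pair2P e; have [[m wx] [n wy]] := (Gconn o x, Gconn o y).
  by exists (m + n)%N => z [] ->; [exists m|exists n] => //; lia.
have [B dB] := finite_set_uniform_bound (perspective_finite_bad_edges conn persp) exB.
suff H n x y : bad_edges Gamma (divider_level a F u n) (pair2 x y) ->
    within Gamma (n * A + B) o x.
  by exists (A + B)%N => n x y /H[m mn w]; exists m => //; nia.
elim: n x y => [|n IHn] x y.
  by move=> /dB[m mB /(_ x)[|r rm w]]; [left|exists r => //; lia].
move=> /(bad_edges_levelS Einv)[f Ff]; rewrite act2_pair2.
move=> /IHn /(within_act f Einv); rewrite -gactM mulgV gact1.
by rewrite mulSn -addnA; apply: within_trans; exact: dA.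
Qed.

(** * Sets of pairs controlled by finitely many edges *)

(** Stated for [shortest] chains rather than geodesics so that it is visibly
    stable under the action. *)
Definition controlled (M : Type) (Gamma : graph M) (v : set (S2 M)) : Prop :=
  exists E : set (S2 M), [/\ finite_set E, E `<=` edges Gamma
    & forall n p, shortest Gamma n p -> segment_edges n p `&` E = set0 ->
        v (segment_boundary n p)].

Lemma filter_controlled (M : Type) (Gamma : graph M) : Filter (controlled Gamma).
Proof.
split=> [|v w [E [finE EG Ev]] [E' [finE' EG' Ew]]|v w vw [E [finE EG Ev]]].
- by exists set0; split.
- exists (E `|` E'); split; first by rewrite finite_setU.
    by move=> e [/EG|/EG'].
  move=> n p sp; rewrite setIUr setU_eq0 => -[/Ev pv /Ew pw].
  by split; [exact: pv|exact: pw].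
- by exists E; split=> // n p sp /Ev pv; apply/vw/pv.
Qed.

Lemma controlled_act (G : groupType) (M : Type) (a : gset G M) (Gamma : graph M)
    (g : G) (v : set (S2 M)) :
    (forall g e, edges Gamma e -> edges Gamma (act2 a g e)) ->
  controlled Gamma v -> controlled Gamma (act2 a g @` v).
Proof.
move=> Einv [E [finE EG Ev]]; exists (act2 a g @` E); split.
- exact: finite_image.
- by move=> _ [e /EG Ee <-]; apply: Einv.
move=> n p sp pE; exists (segment_boundary n (a g^-1%g \o p)); last first.
  by rewrite /segment_boundary /= -act2_pair2 act2VK.
apply: Ev; first by apply: (shortest_act g^-1%g Einv).
rewrite -subset0 => _ [[i i_n <-] Ei].
suff : set0 (pair2 (p i) (p i.+1)) by [].
rewrite -pE; split; first by exists i.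
exists (act2 a g^-1%g (pair2 (p i) (p i.+1))); last by rewrite act2VK.
by rewrite act2_pair2.
Qed.

(** The edges outside one sufficiently deep level control u: this level depends
    only on the constant of [bad_edge_within], hence not on the geodesic. *)
Lemma perspective_divider_controlled (G : groupType) (M : Type) (a : gset G M)
    (Gamma : graph M) (u : set (S2 M)) :
    connecting a Gamma -> is_divider a u -> is_perspective a u ->
  controlled Gamma u.
Proof.
move=> conn [du [F finF Fu]] persp.
have [[o _]|noM] := pselect (exists o : M, True); last first.
  by exists set0; split=> // n p; case: noM; exists (p 0%N).
have [C dC] := bad_edge_within o conn finF persp.
pose K := (2 * C + 1)%N; pose u_ := divider_level a F u.
exists (bad_edges Gamma (u_ (2 * K + 6)%N)); split.
- exact: finite_bad_edges conn finF persp.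
- by move=> e [].
move=> n p sp miss; have pE := sp.1.
apply: (@chain_boundary_level _ u_ K n p).
- by move=> m x; apply: divider_level_diag.
- by move=> m x y z; apply: divider_level_comp.
- by rewrite /K addn1.
- move=> i i_n; apply: contrapT => nu.
  suff : set0 (pair2 (p i) (p i.+1)) by [].
  by rewrite -miss; split; [exists i|split=> //; exact: pE].
move=> m i j ijn nui nuj.
have wi : within Gamma (C * m.+1) o (p i).
  by apply: (dC _ _ (p i.+1)); split=> //; apply: pE; lia.
have wj : within Gamma (C * m.+1) o (p j).
  by apply: (dC _ _ (p j.+1)); split=> //; apply: pE; lia.
have ijn' : (i <= j <= n)%N by lia.
by have := shortest_within sp ijn' wi wj; rewrite /K; nia.
Qed.

Theorem proposition3p5p1 (G : groupType) (M : Type) (a : gset G M)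
    (Mconn : connected_gset a) (Gamma : graph M) (Gconn : connecting a Gamma)
    (Gproper : proper_on_edges a Gamma)
    (U : set_system (S2 M)) (Uhyp : relatively_hyperbolic a U)
    (v : set (S2 M)) (Uv : U v) :
  exists E : set (S2 M),
    [/\ finite_set E, E `<=` edges Gamma
      & forall (n : nat) (p : nat -> M),
          is_geodesic Gamma n p ->
          segment_edges n p `&` E = set0 ->
          v (segment_boundary n p)].
Proof.
case: Uhyp => _ [u [udiv upersp Ueq]] _; have [_ Einv _] := Gconn.
have [E [finE EG Ev]] : controlled Gamma v.
  move: Uv; rewrite Ueq; apply; split; first exact: filter_controlled.
  move=> _ [g _ <-]; apply: controlled_act => //.
  exact: perspective_divider_controlled Gconn udiv upersp.
by exists E; split=> // n p /geodesic_shortest; apply: Ev.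
Qed.
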